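(* On the double tetrahedron $\mathrm{DT}$: (1) Every equihedral metric has constant $\mathcal{L}$-scalar curvature. (2) Every equihedral metric has constant $\mathcal{V}$-scalar curvature. (3) Every conformal class contains an equihedral metric, and it is unique up to scaling all lengths by a positive constant. (4) Constant $\mathcal{L}$-scalar curvature metrics are not necessarily unique (up to scaling) in a conformal class: there is a conformal class on $\mathrm{DT}$ containing two metrics of constant $\mathcal{L}$-scalar curvature that are not scalar multiples of each other.
   Context: The double tetrahedron $\mathrm{DT}$ is the triangulation of $S^3$ obtained by gluing two congruent Euclidean tetrahedra along corresponding boundary faces. It has vertices $1,2,3,4$ and six edges $ij$. A metric is a vector $\ell=(\ell_{ij})$ of positive numbers that are the edge lengths of a nondegenerate Euclidean tetrahedron (the generating tetrahedron); $\mathfrak{met}(\mathrm{DT})$ is the set of metrics. Let $\beta_{ij}\in(0,\pi)$ be the dihedral angle of the generating tetrahedron at edge $ij$, and define $K_{ij}=(2\pi-2\beta_{ij})\ell_{ij}$, $\mathcal{EHR}=\sum_{ij}K_{ij}$, $\mathcal{L}=\sum_{ij}\ell_{ij}$, $\mathcal{V}=$ twice the volume of the generating tetrahedron, $\mathcal{LEHR}=\mathcal{EHR}/\mathcal{L}$, $\mathcal{VEHR}=\mathcal{EHR}/\mathcal{V}^{1/3}$. The conformal class of a metric $L$ is the set of all metrics $\ell\in\mathfrak{met}(\mathrm{DT})$ of the form $\ell_{ij}=\exp[\tfrac12(f_i+f_j)]L_{ij}$ with $f\in\mathbb{R}^4$. For a vertex $v$ put $K_v=\frac12\sum_{e\ni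 v}K_e$, $L_v=\frac12\sum_{e\ni v}\ell_e$ and $$V_v=\frac{\partial\mathcal{V}}{\partial f_v}=\frac12\sum_{e\ni v}\ell_e\frac{\partial\mathcal{V}}{\partial\ell_e},$$ which also equals $\frac13\sum h_{f<t}A_f$ summed over pairs (face $f$ containing $v$, tetrahedron $t$ containing $f$). Here $A_f$ is the area of $f$ and $h_{f<t}$ is the signed distance from the circumcenter of $t$ to the plane of $f$ (positive when the circumcenter is on the same side of $f$ as $t$). A metric has constant $\mathcal{L}$-scalar curvature if $K_v=\lambda L_v$ for all vertices $v$, with $\lambda=\mathcal{LEHR}$. It has constant $\mathcal{V}$-scalar curvature if $K_v=\lambda V_v$ for all vertices $v$, with $\lambda=\mathcal{EHR}/(3\mathcal{V})$. These are the critical points of $\mathcal{LEHR}$, respectively $\mathcal{VEHR}$, under conformal variations. A metric on $\mathrm{DT}$ is equihedral if all four faces of its generating tetrahedron are congruent; equivalently, if opposite edges have equal lengths. *)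

(* Defs.v *)
From HB Require Import structures.
From mathcomp Require Import all_boot all_order all_algebra all_fingroup.
From mathcomp Require Import all_classical all_reals all_analysis.
Set Implicit Arguments.
Unset Strict Implicit.
Unset Printing Implicit Defensive.
Import Order.TTheory GRing.Theory Num.Theory numFieldNormedType.Exports.
Local Open Scope classical_set_scope.
Local Open Scope ring_scope.

Section DoubleTetrahedron.
Context {R : realType}.

(* The norm `|u| that the library puts on 'rV[R]_3 is the sup norm, hence the
   separate Euclidean norm below. *)
Definition dot (u v : 'rV[R]_3) : R := \sum_(k < 3) u 0 k * v 0 k.
Definition enorm (u : 'rV[R]_3) : R := Num.sqrt (dot u u).
Definition angle (u v : 'rV[R]_3) : R := acos (dot u v / (enorm u * enorm v)).
(* component of u orthogonal to e *)
Definition rej (e u : 'rV[R]_3) : 'rV[R]_3 := u - (dot u e / dot e e) *: e.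

(* A tetrahedron in R^3, given by its four vertices. *)
Definition tetrahedron := 'I_4 -> 'rV[R]_3.

Definition edge_vectors (p : tetrahedron) : 'M[R]_3 :=
  \matrix_(i < 3) (p (lift ord0 i) - p ord0).
Definition nondegenerate (p : tetrahedron) : Prop := \det (edge_vectors p) != 0.
Definition tet_volume (p : tetrahedron) : R := `|\det (edge_vectors p)| / 6.

(* Dihedral angle at the edge ij: the angle between the directions, orthogonal
   to the edge, in which the two faces ijk and ijl leave it. *)
Definition tet_dihedral (p : tetrahedron) (i j : 'I_4) : R :=
  let others := enum (~: [set i; j]) in
  let k := nth i others 0 in
  let l := nth i others 1 in
  let e := p j - p i in
  angle (rej e (p k - p i)) (rej e (p l - p i)).

(* A vector of six edge lengths is encoded as a 4 x 4 matrix l, with l i j the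
   length of the edge ij; [generates] forces l to be symmetric, with zero
   diagonal and positive entries off the diagonal. *)
Definition generates (p : tetrahedron) (l : 'M[R]_4) : Prop :=
  nondegenerate p /\ forall i j, l i j = enorm (p i - p j).

Definition met : set 'M[R]_4 := [set l | exists p, generates p l].

(* The generating tetrahedron, unique up to isometry; junk outside [met]. *)
Definition gen_tet (l : 'M[R]_4) : tetrahedron :=
  xget (fun=> 0) [set p | generates p l].

Definition dihedral (l : 'M[R]_4) (i j : 'I_4) : R := tet_dihedral (gen_tet l) i j.
Definition volume (l : 'M[R]_4) : R := 2 * tet_volume (gen_tet l).

Definition K_edge (l : 'M[R]_4) (i j : 'I_4) : R :=
  (2 * pi - 2 * dihedral l i j) * l i j.

Definition EHR (l : 'M[R]_4) : R :=
  \sum_(i < 4) \sum_(j < 4 | (i < j)%N) K_edge l i j.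
Definition total_length (l : 'M[R]_4) : R :=
  \sum_(i < 4) \sum_(j < 4 | (i < j)%N) l i j.
Definition LEHR (l : 'M[R]_4) : R := EHR l / total_length l.

Definition conformal (L : 'M[R]_4) (f : 'rV[R]_4) : 'M[R]_4 :=
  \matrix_(i, j) (expR (2^-1 * (f 0 i + f 0 j)) * L i j).

Definition conformal_class (L : 'M[R]_4) : set 'M[R]_4 :=
  [set l | met l /\ exists f, l = conformal L f].

Definition K_vertex (l : 'M[R]_4) (v : 'I_4) : R :=
  2^-1 * \sum_(j < 4 | j != v) K_edge l v j.
Definition L_vertex (l : 'M[R]_4) (v : 'I_4) : R :=
  2^-1 * \sum_(j < 4 | j != v) l v j.
(* partial derivative of the volume with respect to f_v, at f = 0 *)
Definition V_vertex (l : 'M[R]_4) (v : 'I_4) : R :=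
  'D_(delta_mx 0 v) (fun f : 'rV[R]_4 => volume (conformal l f)) 0.

Definition constant_L_curvature (l : 'M[R]_4) : Prop :=
  forall v, K_vertex l v = LEHR l * L_vertex l v.
Definition constant_V_curvature (l : 'M[R]_4) : Prop :=
  forall v, K_vertex l v = EHR l / (3 * volume l) * V_vertex l v.

(* The faces opposite to v and w are congruent: some bijection between their
   vertices (here extended to all four vertices, v going to w) preserves the
   side lengths. *)
Definition congruent_faces (l : 'M[R]_4) (v w : 'I_4) : Prop :=
  exists s : {perm 'I_4}, s v = w /\
    forall i j, i != v -> j != v -> l (s i) (s j) = l i j.
Definition equihedral (l : 'M[R]_4) : Prop :=
  forall v w, congruent_faces l v w.

End DoubleTetrahedron.

(* Main.v *)
Require Import Defs.
From HB Require Import structures.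
From mathcomp Require Import all_boot all_order all_algebra all_fingroup.
From mathcomp Require Import all_classical all_reals all_analysis.
From mathcomp Require Import ring lra.
Set Implicit Arguments.
Unset Strict Implicit.
Unset Printing Implicit Defensive.
Import Order.TTheory GRing.Theory Num.Theory numFieldNormedType.Exports.
Local Open Scope classical_set_scope.
Local Open Scope ring_scope.

(* Dihedral angles and volume are explicit functions of the squared lengths x_ij,
   the volume being a third of the square root of the Gram determinant.

   The four faces have equal perimeters only if opposite edges are equal; then all
   K_v agree and all L_v agree, which gives (1). For (2), scaling the edges at v by
   exp (t/2) makes the Gram determinant a quadratic polynomial in exp t whose
   logarithmic derivative at t = 0 is 3/2, so V_v = (3/4) V for every v.

   For (3), the equihedral representative has squared lengths l_ij l_km, and it is
   a tetrahedron because Ptolemy's inequality is strict in a nondegenerate one;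
   uniqueness is linear algebra on f.

   For (4), take lengths p and q = 9/(10 p) on two opposite edges and 1 elsewhere.
   These metrics all lie in one conformal class, and the curvature condition is one
   equation in p. Its left-hand side changes sign between p = 3/2 and p = 97/50,
   away from the equihedral solution p = q. *)

(** * The four vertices as literals, and case analysis over them *)

Local Notation o0 := (@Ordinal 4 0 isT).
Local Notation o1 := (@Ordinal 4 1 isT).
Local Notation o2 := (@Ordinal 4 2 isT).
Local Notation o3 := (@Ordinal 4 3 isT).

Lemma forall_ord4 (P : 'I_4 -> Prop) : P o0 -> P o1 -> P o2 -> P o3 -> forall i, P i.
Proof.
move=> P0 P1 P2 P3 [[|[|[|[|//]]]] lti]; by rewrite (bool_irrelevance lti isT).
Qed.

Lemma sum_ord4 (V : nmodType) (F : 'I_4 -> V) :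
  \sum_(i < 4) F i = F o0 + F o1 + F o2 + F o3.
Proof.
rewrite !big_ord_recl big_ord0 addr0 !addrA.
by congr (F _ + F _ + F _ + F _); apply: val_inj.
Qed.

Lemma sum_ord4_cond (V : nmodType) (P : pred 'I_4) (F : 'I_4 -> V) :
  \sum_(i < 4 | P i) F i =
    (if P o0 then F o0 else 0) + (if P o1 then F o1 else 0)
  + (if P o2 then F o2 else 0) + (if P o3 then F o3 else 0).
Proof. by rewrite big_mkcond sum_ord4. Qed.

(** * Squared lengths, Gram determinants and face areas *)

Section Gram.
Context {R : realType}.

(** Gram determinant of the three edge vectors leaving vertex 0, with inner products recovered from
    squared lengths by the law of cosines; it is 36 times the squared volume. *)
Definition gram_det (x01 x02 x03 x12 x13 x23 : R) : R :=
  let g12 := (x01 + x02 - x12) / 2 in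
  let g13 := (x01 + x03 - x13) / 2 in
  let g23 := (x02 + x03 - x23) / 2 in
  x01 * x02 * x03 + 2 * g12 * g13 * g23
  - x01 * g23 ^+ 2 - x02 * g13 ^+ 2 - x03 * g12 ^+ 2.

(* Four times the squared area, as a function of the squared sides. *)
Definition heron (a b c : R) : R := a * b - ((a + b - c) / 2) ^+ 2.

(* Arguments are squared lengths: edge ij first, then ik, im, jk, jm, km. *)
Definition cos_dihedral (e a b c d f : R) : R :=
  ((a + b - f) / 2 * e - (e + a - c) / 2 * ((e + b - d) / 2)) /
  (Num.sqrt (heron e a c) * Num.sqrt (heron e b d)).

Lemma heronC a b c : heron a c b = heron a b c.
Proof. by rewrite /heron; field. Qed.

Lemma cos_dihedral_flip e a b c d f : cos_dihedral e c d a b f = cos_dihedral e a b c d f.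
Proof.
rewrite /cos_dihedral (heronC e a c) (heronC e b d); by congr (_ / _); field.
Qed.

Definition sq (l : 'M[R]_4) i j : R := l i j ^+ 2.

Definition gram_det_of (l : 'M[R]_4) : R :=
  gram_det (sq l o0 o1) (sq l o0 o2) (sq l o0 o3) (sq l o1 o2) (sq l o1 o3) (sq l o2 o3).

Lemma dotE (u v : 'rV[R]_3) :
  dot u v = u 0 0 * v 0 0 + u 0 1 * v 0 1 + u 0 2%:R * v 0 2%:R.
Proof.
rewrite /dot !big_ord_recl big_ord0 addr0 !addrA.
have -> : lift ord0 ord0 = 1 :> 'I_3 by apply: val_inj.
by have -> : lift ord0 (lift ord0 ord0) = 2%:R :> 'I_3 by apply: val_inj.
Qed.

Lemma dot_ge0 (u : 'rV[R]_3) : 0 <= dot u u.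
Proof. by rewrite dotE -!expr2 !addr_ge0 ?sqr_ge0. Qed.

Lemma enorm_sq (u : 'rV[R]_3) : enorm u ^+ 2 = dot u u.
Proof. by rewrite /enorm sqr_sqrtr ?dot_ge0. Qed.

Lemma det_mx3 (M : 'M[R]_3) :
  \det M = M 0 0 * (M 1 1 * M 2%:R 2%:R - M 1 2%:R * M 2%:R 1)
          - M 0 1 * (M 1 0 * M 2%:R 2%:R - M 1 2%:R * M 2%:R 0)
          + M 0 2%:R * (M 1 0 * M 2%:R 1 - M 1 1 * M 2%:R 0).
Proof.
(* Reading the entries through natural-number indices lets the various ordinals produced by the
   cofactor expansion be identified by computation. *)
have [m ME] : exists m : nat -> nat -> R, forall i j, M i j = m i j.
  by exists (fun a b => M (inord a) (inord b)) => i j; rewrite !inord_val.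
rewrite (expand_det_row _ ord0) !big_ord_recl big_ord0 /cofactor.
rewrite !(expand_det_row _ ord0) !big_ord_recl !big_ord0 /cofactor !det_mx11 !mxE.
rewrite !ME /= /bump /=; ring.
Qed.

Lemma det_edge_vectors (p : @tetrahedron R) :
  let u := p o1 - p o0 in let v := p o2 - p o0 in let w := p o3 - p o0 in
  \det (edge_vectors p) =
    u 0 0 * (v 0 1 * w 0 2%:R - v 0 2%:R * w 0 1)
  - u 0 1 * (v 0 0 * w 0 2%:R - v 0 2%:R * w 0 0)
  + u 0 2%:R * (v 0 0 * w 0 1 - v 0 1 * w 0 0).
Proof.
move=> u v w; rewrite det_mx3 !mxE /=.
have -> : lift ord0 (0 : 'I_3) = o1 by apply: val_inj.
have -> : lift ord0 (1 : 'I_3) = o2 by apply: val_inj.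
have -> : lift ord0 (2%:R : 'I_3) = o3 by apply: val_inj.
by have -> : ord0 = o0 by apply: val_inj.
Qed.

Lemma generates_sq (p : @tetrahedron R) l i j : generates p l ->
  sq l i j = dot (p i - p j) (p i - p j).
Proof. by move=> [_ /(_ i j)]; rewrite /sq => ->; exact: enorm_sq. Qed.

Lemma generates_sym (p : @tetrahedron R) l i j : generates p l -> l i j = l j i.
Proof. by move=> [_ E]; rewrite !E /enorm !dotE !mxE; congr Num.sqrt; ring. Qed.

Lemma generates_diag (p : @tetrahedron R) l i : generates p l -> l i i = 0.
Proof. by move=> [_ E]; rewrite E /enorm subrr !dotE !mxE !mul0r !addr0 sqrtr0. Qed.

(** This is det (M M^T) = (det M)^2 for the matrix M of edge vectors, checked as a polynomial
    identity after [p o0] is moved to the origin. *)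
Lemma generates_gdet (p : @tetrahedron R) l : generates p l ->
  gram_det_of l = \det (edge_vectors p) ^+ 2.
Proof.
move=> pl; rewrite det_edge_vectors /gram_det_of !(generates_sq _ _ pl) !dotE !mxE /gram_det /=.
set a0 := p o0 0 0; set a1 := p o0 0 1; set a2 := p o0 0 2%:R.
set b0 := p o1 0 0; set b1 := p o1 0 1; set b2 := p o1 0 2%:R.
set c0 := p o2 0 0; set c1 := p o2 0 1; set c2 := p o2 0 2%:R.
set d0 := p o3 0 0; set d1 := p o3 0 1; set d2 := p o3 0 2%:R.
pose u0 := b0 - a0; pose u1 := b1 - a1; pose u2 := b2 - a2.
pose v0 := c0 - a0; pose v1 := c1 - a1; pose v2 := c2 - a2.
pose w0 := d0 - a0; pose w1 := d1 - a1; pose w2 := d2 - a2.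
rewrite -/u0 -/u1 -/u2 -/v0 -/v1 -/v2 -/w0 -/w1 -/w2.
have -> : (a0 - b0) * (a0 - b0) + (a1 - b1) * (a1 - b1) + (a2 - b2) * (a2 - b2) =
  u0 * u0 + u1 * u1 + u2 * u2 by rewrite /u0 /u1 /u2; clear; ring.
have -> : (a0 - c0) * (a0 - c0) + (a1 - c1) * (a1 - c1) + (a2 - c2) * (a2 - c2) =
  v0 * v0 + v1 * v1 + v2 * v2 by rewrite /v0 /v1 /v2; clear; ring.
have -> : (a0 - d0) * (a0 - d0) + (a1 - d1) * (a1 - d1) + (a2 - d2) * (a2 - d2) =
  w0 * w0 + w1 * w1 + w2 * w2 by rewrite /w0 /w1 /w2; clear; ring.
rewrite (_ : _ / 2 = u0 * v0 + u1 * v1 + u2 * v2); last first.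
  by rewrite /u0 /v0 /u1 /v1 /u2 /v2; clear; field.
rewrite (_ : (_ + _ - (_ + _)) / 2 = u0 * w0 + u1 * w1 + u2 * w2); last first.
  by rewrite /u0 /w0 /u1 /w1 /u2 /w2; clear; field.
rewrite (_ : (_ + _ - (_ + _)) / 2 = v0 * w0 + v1 * w1 + v2 * w2); last first.
  by rewrite /v0 /w0 /v1 /w1 /v2 /w2; clear; field.
move: u0 u1 u2 v0 v1 v2 w0 w1 w2 => u0 u1 u2 v0 v1 v2 w0 w1 w2; clear; ring.
Qed.

Lemma generates_gdet_gt0 (p : @tetrahedron R) l : generates p l -> 0 < gram_det_of l.
Proof.
move=> pl; rewrite (generates_gdet pl) lt0r sqr_ge0 andbT sqrf_eq0.
exact: pl.1.
Qed.

Lemma generates_inj (p : @tetrahedron R) l i j : generates p l -> p i = p j -> i = j.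
Proof.
case=> nd _; move: nd; rewrite /Defs.nondegenerate (det_edge_vectors p) => nd.
case: (eqVneq i j) => //.
have z (T : Type) (x : R) : x != 0 -> x = 0 -> T by move=> /eqP.
move: i j; apply: forall_ord4; apply: forall_ord4 => // _ E; apply: z nd _; rewrite !mxE E; ring.
Qed.

Lemma generates_sq_gt0 (p : @tetrahedron R) l i j : generates p l -> i != j -> 0 < sq l i j.
Proof.
move=> pl nij; rewrite /sq exprn_even_gt0 //= pl.2 /enorm sqrtr_eq0 -ltNge lt0r dot_ge0 andbT.
apply: contra nij => /eqP; rewrite dotE -!expr2 => E.
apply/eqP/(generates_inj pl)/eqP; rewrite -subr_eq0; apply/eqP/rowP => k; rewrite !mxE.
move: E; rewrite !mxE.
set a := _ - _; set b := _ - _; set c := _ - _ => E.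
have a0 : a = 0 by nra.
have b0 : b = 0 by nra.
have c0 : c = 0 by nra.
by case: k => [[|[|[|//]]] lk]; [rewrite -a0|rewrite -b0|rewrite -c0]; rewrite /a /b /c;
  congr (p i _ _ - p j _ _); apply: val_inj.
Qed.

Lemma generates_gt0 (p : @tetrahedron R) l i j : generates p l -> i != j -> 0 < l i j.
Proof.
move=> pl nij; have := generates_sq_gt0 pl nij.
by rewrite /sq exprn_even_gt0 //= lt0r => ->; rewrite pl.2 sqrtr_ge0.
Qed.

(** Heron's expression is the squared norm of the cross product n of the edge vectors from vertex 0
    to vertices 1 and 2. The determinant is the inner product of n with the third edge vector, so n
    = 0 would make it vanish. *)
Lemma generates_heron (p : @tetrahedron R) l : generates p l ->
  0 < heron (sq l o0 o1) (sq l o0 o2) (sq l o1 o2).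
Proof.
move=> pl; have := pl.1; rewrite /Defs.nondegenerate det_edge_vectors.
rewrite !(generates_sq _ _ pl) !dotE !mxE /=.
set a0 := p o0 0 0; set a1 := p o0 0 1; set a2 := p o0 0 2%:R.
set b0 := p o1 0 0; set b1 := p o1 0 1; set b2 := p o1 0 2%:R.
set c0 := p o2 0 0; set c1 := p o2 0 1; set c2 := p o2 0 2%:R.
set d0 := p o3 0 0; set d1 := p o3 0 1; set d2 := p o3 0 2%:R.
set n0 := (b1 - a1) * (c2 - a2) - (b2 - a2) * (c1 - a1).
set n1 := (b2 - a2) * (c0 - a0) - (b0 - a0) * (c2 - a2).
set n2 := (b0 - a0) * (c1 - a1) - (b1 - a1) * (c0 - a0).
move=> nd.
rewrite (_ : heron _ _ _ = n0 ^+ 2 + n1 ^+ 2 + n2 ^+ 2); last first.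
  rewrite /heron /n0 /n1 /n2; by clear; field.
rewrite lt0r !addr_ge0 ?sqr_ge0 // andbT; apply: contra nd => /eqP E.
have z0 : n0 = 0 by nra.
have z1 : n1 = 0 by nra.
have z2 : n2 = 0 by nra.
apply/eqP; transitivity ((d0 - a0) * n0 + (d1 - a1) * n1 + (d2 - a2) * n2).
  by rewrite /n0 /n1 /n2; clear; ring.
by rewrite z0 z1 z2; ring.
Qed.

End Gram.

(** * Realizing lengths by a tetrahedron; formulas for volume and dihedral angles *)

Section Dihedral.
Context {R : realType}.

(** Cholesky factorization: the vertices are placed at 0, (A, 0, 0), (B, C, 0) and (D, E, F).
    Positivity of the leading minors of the Gram matrix makes the square roots defining C and F
    positive. *)
Lemma met_of_gram (l : 'M[R]_4) :
  (forall i j, l i j = l j i) -> (forall i, l i i = 0) -> (forall i j, 0 <= l i j) ->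
  0 < l o0 o1 -> 0 < heron (sq l o0 o1) (sq l o0 o2) (sq l o1 o2) -> 0 < gram_det_of l ->
  met l.
Proof.
move=> lC l0 lp x_gt0; rewrite /gram_det_of /gram_det.
set A := l o0 o1 in x_gt0 *.
set g11 := sq l o0 o1; set g22 := sq l o0 o2; set g33 := sq l o0 o3.
set g12 := (g11 + g22 - _) / 2; set g13 := (g11 + g33 - _) / 2; set g23 := (_ + _ - _) / 2.
move=> hH hD.
set H := heron _ _ _ in hH.
have HE : H = g11 * g22 - g12 ^+ 2 by [].
clearbody H.
have g11E : g11 = A ^+ 2 by [].
clearbody A.
have An0 : A != 0 by rewrite gt_eqF.
pose B := g12 / A.
have Hn0 : H != 0 by rewrite gt_eqF.
(* The squared diagonal entries of the triangular factor are ratios of consecutive leading minors: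
   C^2 = H / [g11], and below F^2 = G / H. *)
pose C := Num.sqrt (H / A ^+ 2).
have C2 : C ^+ 2 = H / A ^+ 2 by rewrite sqr_sqrtr // divr_ge0 ?sqr_ge0 // ltW.
have C_gt0 : 0 < C by rewrite sqrtr_gt0 divr_gt0 // exprn_gt0.
have Cn0 : C != 0 by rewrite gt_eqF.
clearbody C.
pose D := g13 / A.
pose E := (g23 - B * D) / C.
pose G := g11 * g22 * g33 + 2 * g12 * g13 * g23
  - g11 * g23 ^+ 2 - g22 * g13 ^+ 2 - g33 * g12 ^+ 2.
pose F := Num.sqrt (G / H).
have F2 : F ^+ 2 = G / H by rewrite sqr_sqrtr // divr_ge0 // ltW.
have F_gt0 : 0 < F by rewrite sqrtr_gt0 divr_gt0.
clearbody F.
have e12 : A * B = g12 by rewrite /B; field.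
have e22 : B ^+ 2 + C ^+ 2 = g22 by rewrite C2 HE g11E /B; field.
have e13 : A * D = g13 by rewrite /D; field.
have e23 : B * D + C * E = g23 by rewrite /E; field.
have e33 : D ^+ 2 + E ^+ 2 + F ^+ 2 = g33.
  have -> : E ^+ 2 = (g23 - B * D) ^+ 2 * A ^+ 2 / H.
    by rewrite /E exprMn exprVn C2; field; rewrite ?An0 ?Hn0.
  rewrite F2 /G /B /D.
  have {}HE : A ^+ 2 * g22 - g12 ^+ 2 = H by rewrite HE -g11E.
  apply: (mulIf Hn0); rewrite 2!mulrDl !mulfVK // -HE g11E; field.
  by rewrite ?An0 ?Hn0.
pose p : @tetrahedron R := fun i => nth 0
  [:: 0; \row_k nth 0 [:: A; 0; 0] k; \row_k nth 0 [:: B; C; 0] k;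
      \row_k nth 0 [:: D; E; F] k] i.
have x12 : sq l o1 o2 = g11 + g22 - 2 * g12 by rewrite /g12; field.
have x13 : sq l o1 o3 = g11 + g33 - 2 * g13 by rewrite /g13; field.
have x23 : sq l o2 o3 = g22 + g33 - 2 * g23 by rewrite /g23; field.
clearbody g12 g13 g23.
exists p; split.
  rewrite /Defs.nondegenerate det_edge_vectors !mxE /=.
  rewrite (_ : _ + _ = A * C * F); last by ring.
  by rewrite !mulf_neq0 // gt_eqF.
have key i j : sq l i j = dot (p i - p j) (p i - p j) -> l i j = enorm (p i - p j).
  by move=> S; rewrite /enorm -S /sq sqrtr_sqr ger0_norm.
move=> i j; apply: key; move: i j.
have sym (i j : 'I_4) : sq l i j = dot (p i - p j) (p i - p j) ->
    sq l j i = dot (p j - p i) (p j - p i).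
  by rewrite /sq lC => ->; rewrite !dotE !mxE; ring.
have diag i : sq l i i = dot (p i - p i) (p i - p i).
  by rewrite /sq l0 subrr !dotE !mxE; ring.
have s01 : sq l o0 o1 = dot (p o0 - p o1) (p o0 - p o1).
  by rewrite !dotE !mxE /= -/g11 g11E; ring.
have s02 : sq l o0 o2 = dot (p o0 - p o2) (p o0 - p o2).
  by rewrite !dotE !mxE /= -/g22 -e22; ring.
have s03 : sq l o0 o3 = dot (p o0 - p o3) (p o0 - p o3).
  by rewrite !dotE !mxE /= -/g33 -e33; ring.
have s12 : sq l o1 o2 = dot (p o1 - p o2) (p o1 - p o2).
  by rewrite !dotE !mxE /= x12 g11E -e22 -e12; ring.
have s13 : sq l o1 o3 = dot (p o1 - p o3) (p o1 - p o3).
  by rewrite !dotE !mxE /= x13 g11E -e33 -e13; ring.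
have s23 : sq l o2 o3 = dot (p o2 - p o3) (p o2 - p o3).
  by rewrite !dotE !mxE /= x23 -e22 -e33 -e23; ring.
by apply: forall_ord4; apply: forall_ord4 => //; exact: sym.
Qed.

Lemma gen_tetP (l : 'M[R]_4) : met l -> generates (gen_tet l) l.
Proof. exact: xgetPex. Qed.

Lemma volumeE (l : 'M[R]_4) : met l -> volume l = Num.sqrt (gram_det_of l) / 3.
Proof.
by move=> /gen_tetP /generates_gdet ->; rewrite sqrtr_sqr /volume /tet_volume; field.
Qed.

Lemma angleC (u v : 'rV[R]_3) : angle u v = angle v u.
Proof. by rewrite /angle [enorm u * _]mulrC !dotE; congr (acos (_ / _)); ring. Qed.

Lemma dot_rej (e u v : 'rV[R]_3) : dot e e != 0 ->
  dot (rej e u) (rej e v) = (dot u v * dot e e - dot u e * dot v e) / dot e e.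
Proof.
move=> e0; rewrite /rej; move: e0; set c := dot u e / _; set d := dot v e / _.
move=> e0; rewrite (_ : dot (u - _) _ = dot u v - c * dot v e - d * dot u e + c * d * dot e e).
  by rewrite /c /d; field.
by clear; rewrite !dotE !mxE; ring.
Qed.

(** The factor [dot e e] cancels between numerator and denominator. Each radicand left is four times
    the squared area of a face, so that [cos_dihedral] can be recognized. *)
Lemma angle_rej (e u v : 'rV[R]_3) : dot e e != 0 ->
  angle (rej e u) (rej e v) = acos ((dot u v * dot e e - dot u e * dot v e) /
    (Num.sqrt (dot u u * dot e e - dot u e ^+ 2) * Num.sqrt (dot v v * dot e e - dot v e ^+ 2))).
Proof.
move=> e0; rewrite /angle /enorm !dot_rej //.
have ep : 0 < dot e e by rewrite lt0r e0 dot_ge0.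
have H w : Num.sqrt ((dot w w * dot e e - dot w e * dot w e) / dot e e) =
  Num.sqrt (dot w w * dot e e - dot w e ^+ 2) / Num.sqrt (dot e e).
  by rewrite mulrC sqrtrM ?invr_ge0 ?ltW // sqrtrV ?ltW // mulrC.
rewrite !H; congr acos.
set a := Num.sqrt (dot u u * _ - _); set b := Num.sqrt (dot v v * _ - _).
have -> : a / Num.sqrt (dot e e) * (b / Num.sqrt (dot e e)) = a * b / dot e e.
  by rewrite mulrACA -invfM -expr2 sqr_sqrtr // ltW.
by rewrite invf_div mulrA mulfVK.
Qed.

Lemma tet_dihedralE (p : @tetrahedron R) l i j k m : generates p l ->
  uniq [:: i; j; k; m] ->
  tet_dihedral p i j = acos (cos_dihedral (sq l i j) (sq l i k) (sq l i m)
                              (sq l j k) (sq l j m) (sq l k m)).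
Proof.
move=> pl un.
have sE a b : sq l a b = dot (p a - p b) (p a - p b) by exact: generates_sq.
have e0 : dot (p j - p i) (p j - p i) != 0.
  rewrite -sE gt_eqF // (generates_sq_gt0 pl) //.
  by move: un; rewrite /= !inE eq_sym; case: eqVneq.
have gen a b : angle (rej (p j - p i) (p a - p i)) (rej (p j - p i) (p b - p i)) =
  acos (cos_dihedral (sq l i j) (sq l i a) (sq l i b) (sq l j a) (sq l j b) (sq l a b)).
  rewrite angle_rej // /cos_dihedral !sE; congr acos; congr (_ / (Num.sqrt _ * Num.sqrt _));
  by rewrite /heron; clear; rewrite !dotE !mxE; field.
(* The definition of the angle lists the two remaining vertices in the order of [enum], which may be
   k, m or m, k; both orders give the same angle by [angleC]. *)
have : perm_eq (enum (~: [set i; j])) [:: k; m].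
  apply: uniq_perm; first exact: enum_uniq.
    by move: un; rewrite /= !inE; case: (k =P m); rewrite ?orbT ?andbF.
  move=> x; rewrite mem_enum !inE.
  move: un; move: i j k m x {pl e0 gen sE}.
  by do 5![apply: forall_ord4].
rewrite /tet_dihedral => pe.
case E : (enum _) pe => [|a [|b [|c s]]] pe; first by move/perm_size: pe.
- by move/perm_size: pe.
- have /orP[/eqP[-> ->]|/eqP[-> ->]] : ([:: a; b] == [:: k; m]) || ([:: a; b] == [:: m; k]).
    have a_in : a \in [:: k; m] by rewrite -(perm_mem pe) !inE eqxx.
    have b_in : b \in [:: k; m] by rewrite -(perm_mem pe) !inE eqxx orbT.
    have nab : a != b by move: (enum_uniq (~: [set i; j])); rewrite E /= inE; case/andP.
    move: a_in b_in nab; rewrite !inE => /orP[]/eqP-> /orP[]/eqP->; by rewrite ?eqxx ?orbT.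
  - by rewrite /= gen.
  - rewrite /= angleC gen //.
- by move/perm_size: pe.
Qed.

Lemma dihedralE (l : 'M[R]_4) i j k m : met l -> uniq [:: i; j; k; m] ->
  dihedral l i j = acos (cos_dihedral (sq l i j) (sq l i k) (sq l i m)
                              (sq l j k) (sq l j m) (sq l k m)).
Proof. by move=> /gen_tetP pl; exact: tet_dihedralE. Qed.
End Dihedral.

(** * Vertex sums, opposite edges and Ptolemy's inequality *)

Section Equihedral.
Context {R : realType}.
Implicit Types l L : 'M[R]_4.

Lemma met_sym l i j : met l -> l i j = l j i.
Proof. by move=> /gen_tetP /generates_sym. Qed.

Lemma sq_sym l i j : met l -> sq l i j = sq l j i.
Proof. by move=> ml; rewrite /sq (met_sym _ _ ml). Qed.

Lemma met_gt0 l i j : met l -> i != j -> 0 < l i j.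
Proof. by move=> /gen_tetP /generates_gt0; exact. Qed.

Lemma met_diag l i : met l -> l i i = 0.
Proof. by move=> /gen_tetP /generates_diag. Qed.

Lemma dihedralC l i j : met l -> dihedral l i j = dihedral l j i.
Proof.
move=> ml; case: (eqVneq i j) => [->//|nij].
suff [k [m un]] : exists k m, uniq [:: i; j; k; m].
  have un' : uniq [:: j; i; k; m].
    by rewrite -(perm_uniq (s1 := [:: i; j; k; m])) // -[[:: i, j & _]]/([:: i] ++ [:: j] ++ _) perm_catCA.
  rewrite !(dihedralE (k := k) (m := m) ml) // (sq_sym j i ml).
  by rewrite cos_dihedral_flip.
move: i j nij; apply: forall_ord4; apply: forall_ord4 => // _;
 first [by exists o2, o3 | by exists o1, o3 | by exists o1, o2 | by exists o0, o3
       | by exists o0, o2 | by exists o0, o1].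
Qed.

Lemma K_edgeC l i j : met l -> K_edge l i j = K_edge l j i.
Proof. by move=> ml; rewrite /K_edge dihedralC // (met_sym _ _ ml). Qed.

Lemma sum_K_vertex l : met l -> \sum_v K_vertex l v = EHR l.
Proof.
move=> ml; rewrite /K_vertex /EHR.
rewrite !sum_ord4 !sum_ord4_cond /= (K_edgeC o1 o0 ml) (K_edgeC o2 o0 ml) (K_edgeC o3 o0 ml).
by rewrite (K_edgeC o2 o1 ml) (K_edgeC o3 o1 ml) (K_edgeC o3 o2 ml); field.
Qed.

Lemma sum_L_vertex l : met l -> \sum_v L_vertex l v = total_length l.
Proof.
move=> ml; rewrite /L_vertex /total_length.
rewrite !sum_ord4 !sum_ord4_cond /= (met_sym o1 o0 ml) (met_sym o2 o0 ml) (met_sym o3 o0 ml).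
by rewrite (met_sym o2 o1 ml) (met_sym o3 o1 ml) (met_sym o3 o2 ml); field.
Qed.

Lemma total_length_gt0 l : met l -> 0 < total_length l.
Proof.
move=> ml; rewrite /total_length.
rewrite !sum_ord4 !sum_ord4_cond /= !addr0 !add0r.
by rewrite !addr_gt0 // (met_gt0 ml).
Qed.

(** Summing the proportionality over w turns [K_vertex l w] and [L_vertex l w] into [EHR l] and
    [total_length l], so the common ratio can only be [LEHR l]. *)
Lemma constant_L_curvatureP l : met l ->
  (forall v w, K_vertex l v * L_vertex l w = K_vertex l w * L_vertex l v) ->
  constant_L_curvature l.
Proof.
move=> ml KL v; have t0 := gt_eqF (total_length_gt0 ml).
rewrite /LEHR mulrAC; apply: (canRL (mulfK (negbT t0))).
rewrite -(sum_L_vertex ml) -(sum_K_vertex ml) mulr_sumr mulr_suml.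
by apply: eq_bigr => w _.
Qed.

Definition opposite_eq l := [/\ l o0 o1 = l o2 o3, l o0 o2 = l o1 o3 & l o0 o3 = l o1 o2].

(** The congruences may match the edges of two faces in any way; the perimeter is an invariant
    insensitive to the matching, and three equalities of perimeters suffice to solve for the
    lengths. *)
Lemma equihedral_opposite l : met l -> equihedral l -> opposite_eq l.
Proof.
move=> ml el.
(* Twice the perimeter of the face opposite [v], since each edge is counted in both orders. *)
pose per v := \sum_i \sum_j if (i != v) && (j != v) then l i j else 0.
have perE v w : per v = per w.
  have [s [sv sl]] := el v w.
  have sinj : injective s := @perm_inj _ s.
  rewrite /per [RHS](reindex_inj sinj) /=; apply: eq_bigr => i _.
  rewrite [RHS](reindex_inj sinj) /=; apply: eq_bigr => j _.
  rewrite -sv !(inj_eq sinj); case: ifP => // /andP[iv jv].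
  by rewrite sl.
have := (perE o0 o1, perE o0 o2, perE o0 o3); rewrite /per !sum_ord4 /=.
rewrite !(met_diag _ ml) (met_sym o1 o0 ml) (met_sym o2 o0 ml) (met_sym o3 o0 ml).
rewrite (met_sym o2 o1 ml) (met_sym o3 o1 ml) (met_sym o3 o2 ml) => -[[h1 h2] h3].
by split; lra.
Qed.

(* Bitwise exclusive or, the regular action of the Klein four-group on vertices. *)
Definition klein (d i : 'I_4) : 'I_4 :=
  nth o0 (nth [::] [:: [:: o0; o1; o2; o3]; [:: o1; o0; o3; o2];
                       [:: o2; o3; o0; o1]; [:: o3; o2; o1; o0]] d) i.

Lemma kleinK d : involutive (klein d).
Proof. by move: d; apply: forall_ord4; apply: forall_ord4. Qed.

(** The element [klein v w] of the Klein four-group takes [v] to [w], and every element of the group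
    sends each edge to itself or to the opposite edge. *)
Lemma opposite_equihedral l : met l -> opposite_eq l -> equihedral l.
Proof.
move=> ml [e1 e2 e3] v w.
exists (perm (can_inj (kleinK (klein v w)))); split.
  by rewrite permE; move: v w; apply: forall_ord4; apply: forall_ord4.
move=> i j _ _; rewrite !permE; move: (klein v w) i j => {v w}.
have d i : l i i = 0 by exact: met_diag.
have s01 := met_sym o0 o1 ml; have s02 := met_sym o0 o2 ml; have s03 := met_sym o0 o3 ml.
have s12 := met_sym o1 o2 ml; have s13 := met_sym o1 o3 ml; have s23 := met_sym o2 o3 ml.
by apply: forall_ord4; apply: forall_ord4; apply: forall_ord4; rewrite /klein /= ?d //; congruence.
Qed.

Lemma L_vertexE l : met l ->
  [/\ L_vertex l o0 = (l o0 o1 + l o0 o2 + l o0 o3) / 2,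
      L_vertex l o1 = (l o0 o1 + l o1 o2 + l o1 o3) / 2,
      L_vertex l o2 = (l o0 o2 + l o1 o2 + l o2 o3) / 2 &
      L_vertex l o3 = (l o0 o3 + l o1 o3 + l o2 o3) / 2].
Proof.
move=> ml; rewrite /L_vertex !sum_ord4_cond /=.
rewrite (met_sym o1 o0 ml) (met_sym o2 o0 ml) (met_sym o3 o0 ml).
by rewrite (met_sym o2 o1 ml) (met_sym o3 o1 ml) (met_sym o3 o2 ml); split; field.
Qed.

Lemma K_vertexE l : met l ->
  [/\ K_vertex l o0 = (K_edge l o0 o1 + K_edge l o0 o2 + K_edge l o0 o3) / 2,
      K_vertex l o1 = (K_edge l o0 o1 + K_edge l o1 o2 + K_edge l o1 o3) / 2,
      K_vertex l o2 = (K_edge l o0 o2 + K_edge l o1 o2 + K_edge l o2 o3) / 2 &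
      K_vertex l o3 = (K_edge l o0 o3 + K_edge l o1 o3 + K_edge l o2 o3) / 2].
Proof.
move=> ml; rewrite /K_vertex !sum_ord4_cond /=.
rewrite (K_edgeC o1 o0 ml) (K_edgeC o2 o0 ml) (K_edgeC o3 o0 ml).
by rewrite (K_edgeC o2 o1 ml) (K_edgeC o3 o1 ml) (K_edgeC o3 o2 ml); split; field.
Qed.

(** When opposite lengths agree, the dihedral formulas at an edge and at its opposite receive the
    same arguments. *)
Lemma K_edge_opposite l : met l -> opposite_eq l ->
  [/\ K_edge l o0 o1 = K_edge l o2 o3, K_edge l o0 o2 = K_edge l o1 o3
     & K_edge l o0 o3 = K_edge l o1 o2].
Proof.
move=> ml [e1 e2 e3]; rewrite /K_edge e1 e2 e3.
have s := sq_sym _ _ ml.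
have [q1 q2 q3] : [/\ sq l o0 o1 = sq l o2 o3, sq l o0 o2 = sq l o1 o3 & sq l o0 o3 = sq l o1 o2].
  by rewrite /sq e1 e2 e3.
have -> : dihedral l o0 o1 = dihedral l o2 o3.
  rewrite (@dihedralE _ l o0 o1 o2 o3) // (@dihedralE _ l o2 o3 o0 o1) //.
  by rewrite (s o2 o0) (s o2 o1) (s o3 o0) (s o3 o1) q1 q2 q3.
have -> : dihedral l o0 o2 = dihedral l o1 o3.
  rewrite (@dihedralE _ l o0 o2 o1 o3) // (@dihedralE _ l o1 o3 o0 o2) //.
  by rewrite (s o1 o0) (s o2 o1) (s o3 o0) (s o3 o2) q1 q2 q3.
have -> // : dihedral l o0 o3 = dihedral l o1 o2.
rewrite (@dihedralE _ l o0 o3 o1 o2) // (@dihedralE _ l o1 o2 o0 o3) //.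
by rewrite (s o1 o0) (s o3 o1) (s o2 o0) (s o3 o2) q1 q2 q3.
Qed.

Lemma equihedral_K_vertex l : met l -> equihedral l -> forall v, K_vertex l v = EHR l / 4.
Proof.
move=> ml el; have [k1 k2 k3] := K_edge_opposite ml (equihedral_opposite ml el).
have [K0 K1 K2 K3] := K_vertexE ml.
by apply: forall_ord4; rewrite -(sum_K_vertex ml) sum_ord4 K0 K1 K2 K3 k1 k2 k3; field.
Qed.

Lemma equihedral_L_vertex l : met l -> equihedral l -> forall v, L_vertex l v = total_length l / 4.
Proof.
move=> ml el; have [k1 k2 k3] := equihedral_opposite ml el.
have [K0 K1 K2 K3] := L_vertexE ml.
by apply: forall_ord4; rewrite -(sum_L_vertex ml) sum_ord4 K0 K1 K2 K3 k1 k2 k3; field.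
Qed.

Lemma equihedral_constant_L l : met l -> equihedral l -> constant_L_curvature l.
Proof.
move=> ml el; apply: constant_L_curvatureP => // v w.
by rewrite !equihedral_K_vertex ?equihedral_L_vertex.
Qed.

(** Heron's factorization: if a >= b + c, the factor b + c - a is nonpositive and the other three
    are nonnegative. *)
Lemma lt_add_of_heron (a b c : R) : 0 < a -> 0 < b -> 0 < c ->
  0 < 2 * (a ^+ 2 * b ^+ 2 + b ^+ 2 * c ^+ 2 + c ^+ 2 * a ^+ 2) - a ^+ 4 - b ^+ 4 - c ^+ 4 ->
  a < b + c.
Proof.
move=> a0 b0 c0; rewrite (_ : _ - _ = (b + c - a) * ((a + b + c) * ((a + b - c) * (a + c - b))));
  last by ring.
case: (ltP a) => // le pos; suff : 0 < (0 : R) by rewrite ltxx.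
apply: (lt_le_trans pos); apply: mulr_le0_ge0; first by rewrite subr_le0.
by rewrite !mulr_ge0 //; lra.
Qed.

(* The factor of h on the left is 16 times the squared area of a triangle with sides
   l_01 l_23, l_02 l_13, l_03 l_12. *)
Lemma ptolemy_square (x01 x02 x03 x12 x13 x23 : R) :
  let g12 := (x01 + x02 - x12) / 2 in
  let g13 := (x01 + x03 - x13) / 2 in
  let g23 := (x02 + x03 - x23) / 2 in
  let x := x01 * x23 in let y := x02 * x13 in let z := x03 * x12 in
  let h := heron x01 x02 x12 in
  h * (2 * (x * y + y * z + z * x) - x ^+ 2 - y ^+ 2 - z ^+ 2) =
  4 * ((h * x03 + (g12 * g23 - g13 * x02) * x01 + (g12 * g13 - x01 * g23) * x02) ^+ 2
       + gram_det x01 x02 x03 x12 x13 x23 * (x01 * x02 * x12)).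
Proof.
by rewrite /heron /gram_det /=; field.
Qed.

(** In [ptolemy_square] the right-hand side is positive because the Gram determinant is, and so is
    the factor h. Heron's expression in the products of opposite edges is therefore positive, which
    forces the strict triangle inequalities. *)
Lemma ptolemy l : met l ->
  [/\ l o0 o1 * l o2 o3 < l o0 o2 * l o1 o3 + l o0 o3 * l o1 o2,
      l o0 o2 * l o1 o3 < l o0 o1 * l o2 o3 + l o0 o3 * l o1 o2 &
      l o0 o3 * l o1 o2 < l o0 o1 * l o2 o3 + l o0 o2 * l o1 o3].
Proof.
move=> ml; have hH := generates_heron (gen_tetP ml).
have hG := generates_gdet_gt0 (gen_tetP ml).
have := ptolemy_square (sq l o0 o1) (sq l o0 o2) (sq l o0 o3) (sq l o1 o2) (sq l o1 o3) (sq l o2 o3).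
move=> /=; set rhs := RHS => E.
have : 0 < rhs.
  rewrite /rhs mulr_gt0 // ltr_wpDl ?sqr_ge0 // mulr_gt0 //.
  by apply: mulr_gt0; first apply: mulr_gt0; exact: (generates_sq_gt0 (gen_tetP ml)).
rewrite -E pmulr_rgt0 // /sq -!exprMn.
have p i j : i != j -> 0 < l i j by exact: met_gt0.
have := mulr_gt0 (p o0 o1 isT) (p o2 o3 isT).
have := mulr_gt0 (p o0 o2 isT) (p o1 o3 isT).
have := mulr_gt0 (p o0 o3 isT) (p o1 o2 isT).
set x := l o0 o1 * _; set y := l o0 o2 * _; set z := l o0 o3 * _ => z0 y0 x0 H.
by split; apply: lt_add_of_heron => //; lra.
Qed.

(** * Conformal changes: existence and uniqueness of the equihedral metric *)

Lemma conformal_sym L f : met L -> forall i j, conformal L f i j = conformal L f j i.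
Proof. by move=> mL i j; rewrite !mxE (met_sym i j mL) [f 0 i + _]addrC. Qed.

Lemma conformal_diag L f : met L -> forall i, conformal L f i i = 0.
Proof. by move=> mL i; rewrite !mxE (met_diag i mL) mulr0. Qed.

Lemma conformal_gt0 L f i j : met L -> i != j -> 0 < conformal L f i j.
Proof. by move=> mL nij; rewrite mxE mulr_gt0 ?expR_gt0 ?(met_gt0 mL). Qed.

Lemma met_conformal L f : met L -> let l := conformal L f in
  0 < heron (sq l o0 o1) (sq l o0 o2) (sq l o1 o2) -> 0 < gram_det_of l -> met l.
Proof.
move=> mL l hH hG; apply: met_of_gram => //.
- exact: conformal_sym.
- exact: conformal_diag.
- move=> i j; case: (eqVneq i j) => [->|nij]; first by rewrite conformal_diag.
  by rewrite ltW // conformal_gt0.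
- exact: conformal_gt0.
Qed.

(** With y = exp (2 t) x, both exp t * x and exp (- t) * y are the geometric mean of x and y, the
    common length wanted for two opposite edges. *)
Lemma ratio_expR (x y : R) : 0 < x -> 0 < y -> exists t, y = expR t * expR t * x.
Proof.
move=> x0 y0; exists (2^-1 * ln (y / x)).
rewrite -expRD -mulrDl [2^-1 + _](_ : _ = 1); last by field.
by rewrite mul1r lnK ?posrE ?divr_gt0 // mulfVK // gt_eqF.
Qed.

Lemma equihedral_exists L : met L -> exists2 l, conformal_class L l & equihedral l.
Proof.
move=> mL; have p i j : i != j -> 0 < L i j by exact: met_gt0.
have [X EX] := ratio_expR (p o0 o1 isT) (p o2 o3 isT).
have [Y EY] := ratio_expR (p o0 o2 isT) (p o1 o3 isT).
have [Z EZ] := ratio_expR (p o0 o3 isT) (p o1 o2 isT).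
(* Chosen so that edges 01, 02, 03 are scaled by exp X, exp Y, exp Z and their opposites by the
   inverse factors. *)
pose f : 'rV[R]_4 := \row_i nth 0 [:: X + Y + Z; X - Y - Z; Y - X - Z; Z - X - Y] i.
pose l := conformal L f.
have e01 : l o0 o1 = expR X * L o0 o1 by rewrite !mxE /=; congr (expR _ * _); field.
have e02 : l o0 o2 = expR Y * L o0 o2 by rewrite !mxE /=; congr (expR _ * _); field.
have e03 : l o0 o3 = expR Z * L o0 o3 by rewrite !mxE /=; congr (expR _ * _); field.
have e23 : l o2 o3 = expR X * L o0 o1.
  by rewrite !mxE /= EX !mulrA -!expRD; congr (expR _ * _); field.
have e13 : l o1 o3 = expR Y * L o0 o2.
  by rewrite !mxE /= EY !mulrA -!expRD; congr (expR _ * _); field.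
have e12 : l o1 o2 = expR Z * L o0 o3.
  by rewrite !mxE /= EZ !mulrA -!expRD; congr (expR _ * _); field.
(* Each product of opposite lengths of [L] is the square of a new length, so Ptolemy's inequality
   says that a triangle with the new lengths as sides is acute. *)
have := ptolemy mL; rewrite EX EY EZ.
have xE (x y : R) : x * (y * y * x) = (y * x) ^+ 2 by ring.
rewrite !xE -e01 -e02 -e03 -!/(sq _ _ _) => -[t1 t2 t3].
have ml : met l.
  apply: met_conformal => //; rewrite -/l ?/gram_det_of.
    rewrite (_ : sq l o1 o2 = sq l o0 o3); last by rewrite /sq e12 e03.
    set a := sq _ _ _ in t1 t2 t3 *; set b := sq _ _ _ in t1 t2 t3 *; set c := sq _ _ _ in t1 t2 t3 *.
    rewrite /heron (_ : _ - _ = ((b + c - a) * (a + c - b) + (a + c - b) * (a + b - c) +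
      (a + b - c) * (b + c - a)) / 4); last by field.
    by rewrite divr_gt0 // !addr_gt0 // mulr_gt0 //; lra.
  rewrite (_ : sq l o1 o2 = sq l o0 o3); last by rewrite /sq e12 e03.
  rewrite (_ : sq l o1 o3 = sq l o0 o2); last by rewrite /sq e13 e02.
  rewrite (_ : sq l o2 o3 = sq l o0 o1); last by rewrite /sq e23 e01.
  set a := sq _ _ _ in t1 t2 t3 *; set b := sq _ _ _ in t1 t2 t3 *; set c := sq _ _ _ in t1 t2 t3 *.
  (* For equal opposite edges the Gram determinant factors into the three acuteness conditions. *)
  rewrite (_ : gram_det _ _ _ _ _ _ = (b + c - a) * (a + c - b) * (a + b - c) / 2);
    last by rewrite /gram_det; field.
  by rewrite divr_gt0 // !mulr_gt0 //; lra.
exists l; first by split => //; exists f.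
by apply: opposite_equihedral => //; split; rewrite ?e01 ?e02 ?e03 ?e12 ?e13 ?e23.
Qed.

Lemma equihedral_unique L l l' : met L -> conformal_class L l -> equihedral l ->
  conformal_class L l' -> equihedral l' -> exists c : R, 0 < c /\ l' = c *: l.
Proof.
move=> mL [ml [f lE]] el [ml' [g l'E]] el'.
have p i j : i != j -> L i j != 0 by move=> nij; rewrite gt_eqF // (met_gt0 mL).
have := equihedral_opposite ml el; have := equihedral_opposite ml' el'.
rewrite lE l'E /opposite_eq !mxE.
(* Dividing the equality of opposite lengths in one metric by that in the other eliminates [L];
   logarithms leave a linear relation between f and g. *)
have key (a b c d x y : R) : x != 0 -> y != 0 ->
    expR (2^-1 * a) * x = expR (2^-1 * b) * y -> expR (2^-1 * c) * x = expR (2^-1 * d) * y ->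
    a - b = c - d.
  move=> x0 y0 E1 E2.
  have : expR (2^-1 * a) * expR (2^-1 * d) = expR (2^-1 * c) * expR (2^-1 * b).
    apply: (mulIf x0); apply: (mulIf y0).
    transitivity (expR (2^-1 * a) * x * (expR (2^-1 * d) * y)); first by ring.
    by rewrite E1 -E2; ring.
  by rewrite -!expRD => /expR_inj; lra.
move=> [b1 b2 b3] [a1 a2 a3].
have k1 := key _ _ _ _ _ _ (p o0 o1 isT) (p o2 o3 isT) a1 b1.
have k2 := key _ _ _ _ _ _ (p o0 o2 isT) (p o1 o3 isT) a2 b2.
have k3 := key _ _ _ _ _ _ (p o0 o3 isT) (p o1 o2 isT) a3 b3.
exists (expR (g 0 o0 - f 0 o0)); split; first exact: expR_gt0.
apply/matrixP => i j; rewrite !mxE mulrA -expRD; congr (expR _ * _).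
(* The three relations, one for each pair of opposite edges, force g - f to be constant. *)
have gE : forall i, g 0 i = f 0 i + (g 0 o0 - f 0 o0) by apply: forall_ord4; lra.
by rewrite (gE i) (gE j); field.
Qed.

End Equihedral.

(** * First variation of the volume at an equihedral metric *)

Section VolumeVariation.
Context {R : realType}.
Implicit Types l L : 'M[R]_4.

(** Under a conformal change at one vertex, Heron's expression and, for an equihedral metric, the
    Gram determinant take this form. *)
Lemma is_derive_quad_expR (A B C : R) :
  is_derive (0 : R) 1 (fun t => A * expR t ^+ 2 + B * expR t + C) (2 * A + B).
Proof.
pose p : {poly R} := A *: 'X^2 + B *: 'X + C%:P.
have -> : (fun t => A * expR t ^+ 2 + B * expR t + C) = (horner p) \o expR.
  by apply/funext => t; rewrite /p /= !hornerE; ring.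
apply: (is_derive_eq (is_derive1_comp (is_derive_poly p (expR 0)) (is_derive_expR 0))).
rewrite expR0 mulr1 /p !derivD !derivZ derivXn derivX derivC !hornerE; ring.
Qed.

Lemma near_quad_expR_gt0 (A B C : R) : 0 < A + B + C ->
  \forall t \near (0 : R), 0 < A * expR t ^+ 2 + B * expR t + C.
Proof.
move=> pos; have := is_derive_quad_expR A B C.
case=> /derivable1_diffP/differentiable_continuous + _ => ct.
by apply: (cvgr_gt _ ct); rewrite expR0 expr1n !mulr1.
Qed.

Lemma sq_conformal_delta l v (t : R) i j :
  sq (conformal l (t *: delta_mx 0 v)) i j =
  (if i == v then expR t else 1) * (if j == v then expR t else 1) * sq l i j.
Proof.
rewrite /sq !mxE exprMn; congr (_ * _).
rewrite expr2 -expRD -mulrDl [2^-1 + _](_ : _ = 1) ?mul1r; last by field.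
rewrite ?eqxx /= expRD.
by case: (i == v); case: (j == v); rewrite ?(mulr1, mulr0, expR0, mul1r).
Qed.

(** The change multiplies the squared lengths at [v] by exp t and keeps the opposite face; the Klein
    symmetry makes the coefficients independent of [v]. *)
Lemma equihedral_gdet l v (t : R) : met l -> equihedral l ->
  let a := sq l o0 o1 in let b := sq l o0 o2 in let c := sq l o0 o3 in
  gram_det_of (conformal l (t *: delta_mx 0 v)) =
  ((a ^+ 2 * (b + c) + b ^+ 2 * (a + c) + c ^+ 2 * (a + b)
     - a ^+ 3 - b ^+ 3 - c ^+ 3 - 3 * a * b * c) / 4) * expR t ^+ 2
  + ((a ^+ 2 * (b + c) + b ^+ 2 * (a + c) + c ^+ 2 * (a + b)
     - a ^+ 3 - b ^+ 3 - c ^+ 3) / 4) * expR t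
  + - (a * b * c / 4).
Proof.
move=> ml /(equihedral_opposite ml) [e1 e2 e3] /=.
rewrite /gram_det_of !sq_conformal_delta.
have -> : sq l o2 o3 = sq l o0 o1 by rewrite /sq e1.
have -> : sq l o1 o3 = sq l o0 o2 by rewrite /sq e2.
have -> : sq l o1 o2 = sq l o0 o3 by rewrite /sq e3.
move: (sq l o0 o1) (sq l o0 o2) (sq l o0 o3) (expR t) => a b c s.
by move: v; apply: forall_ord4; rewrite /gram_det /=; field.
Qed.

(** Turns the directional derivative in [V_vertex] into a one-variable derivative, where the chain
    rule for [expR] and the square root applies. *)
Lemma derive_along_line (V W : normedModType R) (F : V -> W) (v : V) :
  'D_v F 0 = 'D_1 (fun t : R => F (t *: v)) 0.
Proof.
rewrite /derive; suff -> : (fun h : R => h^-1 *: ((F \o shift 0) (h *: v) - F 0)) =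
  (fun h : R => h^-1 *: (((fun t : R => F (t *: v)) \o shift 0) (h *: 1) - F (0 *: v))) by [].
by apply/funext => h /=; rewrite !addr0 scale0r [h *: 1]mulr1.
Qed.

(** The volume formula is available only on [met], so differentiating it requires metrics for all t
    near 0. The conditions of [met_conformal] are strict inequalities between continuous functions
    of t that hold at t = 0. *)
Lemma near_met_conformal l v : met l -> equihedral l ->
  \forall t \near (0 : R), met (conformal l (t *: delta_mx 0 v)).
Proof.
move=> ml el.
have c0 : conformal l ((0 : R) *: delta_mx 0 v) = l.
  by apply/matrixP => i j; rewrite !mxE !mul0r addr0 mulr0 expR0 mul1r.
have hG : \forall t \near (0 : R), 0 < gram_det_of (conformal l (t *: delta_mx 0 v)).
  near=> t; rewrite equihedral_gdet //; near: t.
  apply: near_quad_expR_gt0; have := generates_gdet_gt0 (gen_tetP ml).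
  rewrite -{1}c0 equihedral_gdet // expR0 expr1n !mulr1; exact.
have [A [B [C hE]]] : exists A B C : R, forall t,
    heron (sq (conformal l (t *: delta_mx 0 v)) o0 o1)
          (sq (conformal l (t *: delta_mx 0 v)) o0 o2)
          (sq (conformal l (t *: delta_mx 0 v)) o1 o2) =
    A * expR t ^+ 2 + B * expR t + C.
  pose a := sq l o0 o1; pose b := sq l o0 o2; pose c := sq l o1 o2.
  (* Coefficients of Heron's expression when the squared sides x and y are scaled and z is kept.
     Vertex 3 is not on this face, hence the constant last entry of [r]. *)
  pose q (x y z : R) : R * R * R := (- (x - y) ^+ 2 / 4, (x + y) * z / 2, - z ^+ 2 / 4).
  pose r := nth (0, 0, 0) [:: q a b c; q a c b; q b c a; (0, 0, heron a b c)] v.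
  exists r.1.1, r.1.2, r.2 => t; rewrite !sq_conformal_delta /r -/a -/b -/c.
  by move: (v); apply: forall_ord4; rewrite /heron /q /=; field.
have hH : \forall t \near (0 : R),
    0 < heron (sq (conformal l (t *: delta_mx 0 v)) o0 o1)
          (sq (conformal l (t *: delta_mx 0 v)) o0 o2)
          (sq (conformal l (t *: delta_mx 0 v)) o1 o2).
  near=> t; rewrite hE; near: t.
  apply: near_quad_expR_gt0; have := generates_heron (gen_tetP ml).
  by rewrite -{1 2 3}c0 hE expR0 expr1n !mulr1.
near=> t; apply: met_conformal => //.
- by near: t.
- by near: t.
Unshelve. all: by end_near.
Qed.

Lemma equihedral_V_vertex l v : met l -> equihedral l -> V_vertex l v = 3 / 4 * volume l.
Proof.
move=> ml el; rewrite /V_vertex.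
pose G (t : R) : R := volume (conformal l (t *: delta_mx 0 v)).
transitivity ('D_1 G (0 : R)).
  exact: derive_along_line.
set a := sq l o0 o1; set b := sq l o0 o2; set c := sq l o0 o3.
have gE := equihedral_gdet v _ ml el; rewrite /= -/a -/b -/c in gE.
set A := _ / 4 in gE; set B := _ / 4 in gE; set C := - _ in gE.
have c0 : conformal l ((0 : R) *: delta_mx 0 v) = l.
  by apply/matrixP => i j; rewrite !mxE !mul0r addr0 mulr0 expR0 mul1r.
have g0 : gram_det_of l = A + B + C by rewrite -{1}c0 gE expR0 expr1n !mulr1.
have pos : 0 < A + B + C by rewrite -g0 (generates_gdet_gt0 (gen_tetP ml)).
have dS : is_derive (0 : R) 1 (fun t => (3^-1 : R) *: Num.sqrt (A * expR t ^+ 2 + B * expR t + C))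
   (3^-1 *: ((2 * Num.sqrt (A + B + C))^-1 * (2 * A + B))).
  apply: is_deriveZ.
  apply: (is_derive1_comp (f := Num.sqrt)); last exact: is_derive_quad_expR.
  by rewrite expR0 expr1n !mulr1; apply: is_derive1_sqrt.
rewrite (near_eq_derive (g := fun t => (3^-1 : R) *: Num.sqrt (A * expR t ^+ 2 + B * expR t + C))).
  rewrite (@derive_val _ _ _ _ _ _ _ dS) volumeE // g0.
  (* The logarithmic derivative 3/2 of the Gram determinant; the square root halves it to 3/4. *)
  have -> : 2 * A + B = 3 / 2 * (A + B + C) by rewrite /A /B /C; field.
  have s0 : Num.sqrt (A + B + C) != 0 by rewrite sqrtr_eq0 -ltNge.
  rewrite -{2}(sqr_sqrtr (ltW pos)) /GRing.scale /=; move: s0.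
  by set s := Num.sqrt _ => s0; field.
near=> t; rewrite /G volumeE; last by near: t; exact: near_met_conformal.
by rewrite gE /GRing.scale /= mulrC.
Unshelve. all: by end_near.
Qed.

Lemma equihedral_constant_V l : met l -> equihedral l -> constant_V_curvature l.
Proof.
move=> ml el v; rewrite equihedral_K_vertex // equihedral_V_vertex //.
suff v0 : volume l != 0 by field.
rewrite volumeE // mulf_neq0 ?invr_eq0 ?pnatr_eq0 // sqrtr_eq0 -ltNge.
exact: generates_gdet_gt0 (gen_tetP ml).
Qed.
End VolumeVariation.

(** * A conformal class with two metrics of constant L-scalar curvature *)

Section Nonuniqueness.
Context {R : realType}.

Lemma le_acos (x y : R) : -1 <= x -> x <= y -> y <= 1 -> acos y <= acos x.
Proof.
move=> x1 xy y1; rewrite leNgt; apply/negP => h.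
have xi : -1 <= x <= 1 by rewrite x1 (le_trans xy).
have yi : -1 <= y <= 1 by rewrite y1 (le_trans x1).
move: h; rewrite -ltr_cos ?in_itv /= ?acos_ge0 ?acos_lepi //.
by rewrite !acosK ?in_itv //= ltNge xy.
Qed.

(** The cosine of pi / 4 has square 1/2, which is less than (4/5)^2. *)
Lemma acos_le_piquarter (x : R) : 4 / 5 <= x -> x <= 1 -> acos x <= pi / 4.
Proof.
move=> x1 x2; have pi0 := pi_gt0 R.
have c2 : cos (pi / 4 : R) ^+ 2 = 1 / 2.
  have := cos_mulr2n (pi / 4 : R); rewrite (_ : (pi / 4) *+ 2 = pi / 2); last by field.
  by rewrite cos_pihalf => /eqP; rewrite eq_sym subr_eq0 => /eqP; lra.
rewrite -[leRHS]cosK ?in_itv /=; last by apply/andP; split; lra.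
apply: le_acos => //; first exact: cos_geN1.
apply: le_trans x1; rewrite leNgt; apply/negP => h.
by nra.
Qed.

(** * The two-parameter family of metrics *)

Definition pq_metric (p q : R) : 'M[R]_4 := \matrix_(i, j)
  nth 0 (nth [::] [:: [:: 0; p; 1; 1]; [:: p; 0; 1; 1];
                      [:: 1; 1; 0; q]; [:: 1; 1; q; 0]] i) j.

(** Cosine of the dihedral angle of [pq_metric p q] at the edge of length p; [cos_side] is the one
    at the four unit edges. *)
Definition cos_pq (p q : R) : R := 1 - 2 * q ^+ 2 / (4 - p ^+ 2).
Definition cos_side (p q : R) : R := p * q / Num.sqrt ((4 - p ^+ 2) * (4 - q ^+ 2)).

(** The Gram determinant is p^2 q^2 (4 - p^2 - q^2) / 4, so the last hypothesis expresses
    nondegeneracy. *)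
Lemma pq_met (p q : R) : 0 < p -> 0 < q -> p ^+ 2 + q ^+ 2 < 4 -> met (pq_metric p q).
Proof.
move=> p0 q0 pq.
have P0 : 0 < p ^+ 2 by rewrite exprn_gt0.
have Q0 : 0 < q ^+ 2 by rewrite exprn_gt0.
apply: met_of_gram.
- by apply: forall_ord4; apply: forall_ord4; rewrite !mxE.
- by apply: forall_ord4; rewrite !mxE.
- by apply: forall_ord4; apply: forall_ord4; rewrite !mxE //= ltW.
- by rewrite !mxE.
- rewrite /sq !mxE /= /heron (_ : _ - _ = p ^+ 2 * (4 - p ^+ 2) / 4); last by field.
  by rewrite divr_gt0 // mulr_gt0 //; lra.
- rewrite /gram_det_of /sq !mxE /= /gram_det.
  rewrite (_ : _ - _ = p ^+ 2 * q ^+ 2 * (4 - p ^+ 2 - q ^+ 2) / 4); last by field.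
  by rewrite divr_gt0 // !mulr_gt0 //; lra.
Qed.

Lemma pq_conformal (p q p' q' : R) : 0 < p -> 0 < q -> 0 < p' -> 0 < q' -> p * q = p' * q' ->
  exists f, pq_metric p' q' = conformal (pq_metric p q) f.
Proof.
move=> p0 q0 p'0 q'0 E; pose t := ln (p' / p).
have et : expR t = p' / p by rewrite lnK // posrE divr_gt0.
(* Opposite weights on the two edges leave the unit edges alone, scale p by exp t and scale q by exp
   (- t), which is q' / q because the products agree. *)
exists (\row_i nth 0 [:: t; t; - t; - t] i); apply/matrixP.
have h1 : expR (2^-1 * (t + t)) = p' / p by rewrite -et; congr expR; field.
have h2 : expR (2^-1 * (- t - t)) = q' / q.
  rewrite (_ : 2^-1 * _ = - t); last by field.
  rewrite expRN et invf_div; apply/eqP.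
  rewrite eqr_div; [|by rewrite gt_eqF|by rewrite gt_eqF].
  by rewrite E mulrC.
have h3 : expR (2^-1 * (t - t)) = 1 by rewrite subrr mulr0 expR0.
have h4 : expR (2^-1 * (- t + t)) = 1 by rewrite addNr mulr0 expR0.
by apply: forall_ord4; apply: forall_ord4;
  rewrite !mxE /= ?mulr0 // ?h1 ?h2 ?h3 ?h4 ?mul1r // mulfVK // gt_eqF.
Qed.

Lemma cos_dihedral_pq (p q : R) : 0 < p -> p ^+ 2 < 4 ->
  cos_dihedral (p ^+ 2) 1 1 1 1 (q ^+ 2) = cos_pq p q.
Proof.
move=> p0 pq; have P0 : 0 < p ^+ 2 by rewrite exprn_gt0.
have hE : heron (p ^+ 2) 1 1 = p ^+ 2 * (4 - p ^+ 2) / 4 by rewrite /heron; field.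
rewrite /cos_dihedral -[Num.sqrt _ * _]expr2 sqr_sqrtr hE; last by rewrite ltW // divr_gt0 // mulr_gt0 //; lra.
have pn : p != 0 by rewrite gt_eqF.
have p4 : 4 - p ^+ 2 != 0 by rewrite gt_eqF //; lra.
by rewrite /cos_pq; field; rewrite pn p4.
Qed.

Lemma cos_dihedral_side (p q : R) : 0 < p -> 0 < q -> p ^+ 2 + q ^+ 2 < 4 ->
  cos_dihedral 1 (p ^+ 2) 1 1 (q ^+ 2) 1 = cos_side p q.
Proof.
move=> p0 q0 pq.
have P0 : 0 < p ^+ 2 by rewrite exprn_gt0.
have Q0 : 0 < q ^+ 2 by rewrite exprn_gt0.
rewrite /cos_dihedral.
have -> : heron 1 (p ^+ 2) 1 = (p / 2) ^+ 2 * (4 - p ^+ 2) by rewrite /heron; field.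
have -> : heron 1 1 (q ^+ 2) = (q / 2) ^+ 2 * (4 - q ^+ 2) by rewrite /heron; field.
rewrite (sqrtrM _ (sqr_ge0 (p / 2))) (sqrtrM _ (sqr_ge0 (q / 2))) !sqrtr_sqr !gtr0_norm ?divr_gt0 //.
rewrite /cos_side sqrtrM; last by lra.
have s1 : Num.sqrt (4 - p ^+ 2) != 0 by rewrite sqrtr_eq0 -ltNge; lra.
have s2 : Num.sqrt (4 - q ^+ 2) != 0 by rewrite sqrtr_eq0 -ltNge; lra.
have pn : p != 0 by rewrite gt_eqF.
have qn : q != 0 by rewrite gt_eqF.
move: s1 s2; set a := Num.sqrt _; set b := Num.sqrt _ => s1 s2.
by field; rewrite ?pn ?qn ?s1 ?s2.
Qed.

Lemma cos_pq_bounds (p q : R) : 0 < q ^+ 2 -> p ^+ 2 + q ^+ 2 < 4 -> -1 < cos_pq p q < 1.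
Proof.
move=> q0 pq; have d0 : 0 < 4 - p ^+ 2 by have := sqr_ge0 p; lra.
have : 2 * q ^+ 2 / (4 - p ^+ 2) < 2 by rewrite ltr_pdivrMr //; lra.
have : 0 < 2 * q ^+ 2 / (4 - p ^+ 2) by rewrite divr_gt0 // mulr_gt0.
by rewrite /cos_pq; lra.
Qed.

(* (K_0 L_2 - K_2 L_0) up to a constant factor; the multiples of pi cancel. *)
Definition balance (p q : R) : R :=
  let bp := acos (cos_pq p q) in let bq := acos (cos_pq q p) in let g := acos (cos_side p q) in
  p * q * (bq - bp) + 2 * p * (g - bp) + 2 * q * (bq - g).

Lemma pq_constant_L (p q : R) : 0 < p -> 0 < q -> p ^+ 2 + q ^+ 2 < 4 ->
  balance p q = 0 -> constant_L_curvature (pq_metric p q).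
Proof.
move=> p0 q0 pq; set l := pq_metric p q; rewrite /balance.
have ml : met l by exact: pq_met.
have P0 : 0 < p ^+ 2 by rewrite exprn_gt0.
have Q0 : 0 < q ^+ 2 by rewrite exprn_gt0.
have pq' : p ^+ 2 < 4 by lra.
have qp' : q ^+ 2 < 4 by lra.
set bp := acos (cos_pq p q); set bq := acos (cos_pq q p).
set g := acos (cos_side p q) => /= bal.
have d01 : dihedral l o0 o1 = bp.
  rewrite (@dihedralE _ l o0 o1 o2 o3) // /sq !mxE /= !expr1n.
  by rewrite cos_dihedral_pq.
have d23 : dihedral l o2 o3 = bq.
  rewrite (@dihedralE _ l o2 o3 o0 o1) // /sq !mxE /= !expr1n.
  by rewrite cos_dihedral_pq.
have d02 : dihedral l o0 o2 = g.
  by rewrite (@dihedralE _ l o0 o2 o1 o3) // /sq !mxE /= !expr1n cos_dihedral_side.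
have d03 : dihedral l o0 o3 = g.
  by rewrite (@dihedralE _ l o0 o3 o1 o2) // /sq !mxE /= !expr1n cos_dihedral_side.
have d12 : dihedral l o1 o2 = g.
  by rewrite (@dihedralE _ l o1 o2 o0 o3) // /sq !mxE /= !expr1n cos_dihedral_side.
have d13 : dihedral l o1 o3 = g.
  by rewrite (@dihedralE _ l o1 o3 o0 o2) // /sq !mxE /= !expr1n cos_dihedral_side.
have [k0 k1 k2 k3] := K_vertexE ml; have [h0 h1 h2 h3] := L_vertexE ml.
apply: constant_L_curvatureP => //.
(* Both sides contain the same multiple 2 (p + 2) (q + 2) of pi; what remains of the difference is
   twice [balance p q]. *)
have key : ((2 * pi - 2 * bp) * p + 2 * (2 * pi - 2 * g)) * (q + 2) =
  ((2 * pi - 2 * bq) * q + 2 * (2 * pi - 2 * g)) * (p + 2).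
  apply/eqP; rewrite -subr_eq0 -[X in _ == X](mulr0 2) -[X in _ == 2 * X]bal; apply/eqP; ring.
have lE : [/\ l o0 o1 = p, l o2 o3 = q, l o0 o2 = 1 & l o0 o3 = 1] by rewrite !mxE.
have [l01 l23 l02 l03] := lE.
have l12 : l o1 o2 = 1 by rewrite mxE.
have l13 : l o1 o3 = 1 by rewrite mxE.
have kE : [/\ K_vertex l o0 = ((2 * pi - 2 * bp) * p + 2 * (2 * pi - 2 * g)) / 2,
   K_vertex l o1 = ((2 * pi - 2 * bp) * p + 2 * (2 * pi - 2 * g)) / 2,
   K_vertex l o2 = ((2 * pi - 2 * bq) * q + 2 * (2 * pi - 2 * g)) / 2 &
   K_vertex l o3 = ((2 * pi - 2 * bq) * q + 2 * (2 * pi - 2 * g)) / 2].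
  rewrite k0 k1 k2 k3 /K_edge d01 d02 d03 d12 d13 d23 l01 l02 l03 l12 l13 l23.
  by split; field.
have hE : [/\ L_vertex l o0 = (p + 2) / 2, L_vertex l o1 = (p + 2) / 2,
    L_vertex l o2 = (q + 2) / 2 & L_vertex l o3 = (q + 2) / 2].
  by rewrite h0 h1 h2 h3 l01 l02 l03 l12 l13 l23; split; field.
move: kE hE key; set A := _ + 2 * _; set B := _ + 2 * _.
move=> [K0 K1 K2 K3] [L0 L1 L2 L3] key.
have key' : A / 2 * ((q + 2) / 2) = B / 2 * ((p + 2) / 2).
  rewrite (_ : _ * _ = A * (q + 2) / 4); last by field.
  by rewrite key; field.
by apply: forall_ord4; apply: forall_ord4; rewrite ?K0 ?K1 ?K2 ?K3 ?L0 ?L1 ?L2 ?L3.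
Qed.

(** The cosines are ordered so that bp <= g <= bq in the notation of [balance], which makes every
    summand nonnegative. *)
Lemma balance_pos : 0 <= balance (3 / 2) (3 / 5).
Proof.
have sB : 5 / 2 <= Num.sqrt ((4 - (3 / 2) ^+ 2) * (4 - (3 / 5) ^+ 2) : R).
  by rewrite -[leLHS]ger0_norm -?sqrtr_sqr ?ler_wsqrtr //; lra.
have s0 : 0 < Num.sqrt ((4 - (3 / 2) ^+ 2) * (4 - (3 / 5) ^+ 2) : R) by apply: lt_le_trans sB; lra.
have cs0 : 0 <= cos_side (3 / 2) (3 / 5) by rewrite /cos_side divr_ge0 ?ltW // !mulr_gt0 //; lra.
have cs1 : cos_side (3 / 2) (3 / 5) <= 1 / 2 by rewrite /cos_side ler_pdivrMr //; lra.
have cpE : cos_pq (3 / 2) (3 / 5) = 103 / 175 by rewrite /cos_pq; field.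
have cqE : cos_pq (3 / 5) (3 / 2) = - (43 / 182) by rewrite /cos_pq; field.
rewrite /balance cpE cqE; set c := cos_side _ _ in cs0 cs1 *.
have h1 : acos (103 / 175 : R) <= acos c by apply: le_acos; lra.
have h2 : acos c <= acos (- (43 / 182) : R) by apply: le_acos; lra.
lra.
Qed.

(** The tetrahedron is nearly flat: bp >= 3 pi / 4 and g <= pi / 4, so together with bq <= pi the
    negative term 2 p (g - bp) dominates. *)
Lemma balance_neg : balance (97 / 50) (45 / 97) <= 0.
Proof.
have sB : Num.sqrt ((4 - (97 / 50) ^+ 2) * (4 - (45 / 97) ^+ 2) : R) <= 95 / 100.
  by rewrite -[leRHS]ger0_norm -?sqrtr_sqr ?ler_wsqrtr //; lra.
have s0 : 0 < Num.sqrt ((4 - (97 / 50) ^+ 2) * (4 - (45 / 97) ^+ 2) : R).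
  by rewrite sqrtr_gt0; lra.
have sL : 9 / 10 <= Num.sqrt ((4 - (97 / 50) ^+ 2) * (4 - (45 / 97) ^+ 2) : R).
  by rewrite -[leLHS]ger0_norm -?sqrtr_sqr ?ler_wsqrtr //; lra.
have cs0 : 4 / 5 <= cos_side (97 / 50) (45 / 97) by rewrite /cos_side ler_pdivlMr //; lra.
have cs1 : cos_side (97 / 50) (45 / 97) <= 1 by rewrite /cos_side ler_pdivrMr //; lra.
have dE : 4 - (97 / 50) ^+ 2 = 591 / 2500 :> R by lra.
have P0 : 0 < (97 / 50 : R) ^+ 2 by rewrite exprn_gt0.
have PQ : (45 / 97 : R) ^+ 2 + (97 / 50) ^+ 2 < 4 by lra.
have cp1 : -1 <= cos_pq (97 / 50) (45 / 97) by rewrite /cos_pq dE invf_div; lra.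
have cp2 : cos_pq (97 / 50) (45 / 97) <= - (4 / 5) by rewrite /cos_pq dE invf_div; lra.
have cq1 : -1 <= cos_pq (45 / 97) (97 / 50) <= 1.
  by case/andP: (cos_pq_bounds P0 PQ) => /ltW-> /ltW->.
rewrite /balance; set c := cos_side _ _ in cs0 cs1 *; set cp := cos_pq _ _ in cp1 cp2 *.
set cq := cos_pq _ _ in cq1 *.
have h1 : acos c <= pi / 4 by exact: acos_le_piquarter.
have h2 := acos_lepi cq1.
(* The angle at the long edge is obtuse, so its supplement is estimated. *)
have h3 : acos (- cp) <= pi / 4 by apply: acos_le_piquarter; lra.
have h4 : acos (- cp) = pi - acos cp by rewrite acosN //; lra.
have h5 := pi_gt0 R.
lra.
Qed.

(** Along the curve p q = 9/10 this interval stays among nondegenerate metrics and away from p =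
    q. *)
Lemma pq_range (x : R) : 3 / 2 <= x <= 97 / 50 ->
  [/\ 0 < x, 0 < 9 / 10 / x, x ^+ 2 + (9 / 10 / x) ^+ 2 < 4 & 9 / 10 / x < x].
Proof.
move=> /andP[x1 x2]; have x0 : 0 < x by lra.
set q := 9 / 10 / x; have qx : q * x = 9 / 10 by rewrite /q mulfVK ?gt_eqF.
have q0 : 0 < q by rewrite /q divr_gt0 //; lra.
split => //; last by nra.
have P1 : 9 / 4 <= x ^+ 2 by nra.
have P2 : x ^+ 2 <= 9409 / 2500 by nra.
have PQ : q ^+ 2 * x ^+ 2 = 81 / 100 by rewrite -exprMn qx; lra.
(* Multiplication by x^2 leaves the quadratic inequality P^2 + 81/100 < 4 P in P = x^2; by convexity
   it is governed by the ends of the interval. *)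
rewrite -(ltr_pM2r (exprn_gt0 2 x0)) mulrDl PQ.
move: P1 P2; set P := x ^+ 2 => P1 P2; nra.
Qed.

Lemma continuous_balance (x : R) : 3 / 2 <= x <= 97 / 50 ->
  {for x, continuous (fun x => balance x (9 / 10 / x))}.
Proof.
move=> /pq_range; pose q (y : R) := 9 / 10 / y; rewrite -/(q x) => -[x0 q0 pq _].
have cx : y @[y --> x] --> x by exact: cvg_id.
have cq : q y @[y --> x] --> q x.
  by apply: cvgM; [exact: cvg_cst|apply: cvgV => //; rewrite gt_eqF].
have P0 : 0 < x ^+ 2 by rewrite exprn_gt0.
have Q0 : 0 < (q x) ^+ 2 by rewrite exprn_gt0.
have c4 (f : R -> R) : f y @[y --> x] --> f x -> 4 - f y ^+ 2 @[y --> x] --> 4 - f x ^+ 2.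
  by move=> cf; apply: cvgB; [exact: cvg_cst|exact: (cvgM cf cf)].
have cpq (f g : R -> R) : f y @[y --> x] --> f x -> g y @[y --> x] --> g x ->
    0 < g x ^+ 2 -> f x ^+ 2 + g x ^+ 2 < 4 ->
    acos (cos_pq (f y) (g y)) @[y --> x] --> acos (cos_pq (f x) (g x)).
  move=> cf cg g0 fg; have d0 : 0 < 4 - f x ^+ 2 by lra.
  apply: (@continuous_cvg _ _ _ _ _ (fun y => cos_pq (f y) (g y)) (@acos R)).
    by apply: continuous_acos; exact: cos_pq_bounds.
  rewrite /cos_pq; apply: cvgB; first exact: cvg_cst.
  apply: cvgM; first by apply: cvgM; [exact: cvg_cst|exact: (cvgM cg cg)].
  by apply: cvgV; [rewrite gt_eqF|exact: c4].
have cs : acos (cos_side y (q y)) @[y --> x] --> acos (cos_side x (q x)).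
  have D0 : 0 < (4 - x ^+ 2) * (4 - q x ^+ 2) by apply: mulr_gt0; lra.
  have S0 : 0 < Num.sqrt ((4 - x ^+ 2) * (4 - q x ^+ 2)) by rewrite sqrtr_gt0.
  apply: (@continuous_cvg _ _ _ _ _ (fun y => cos_side y (q y)) (@acos R)).
    apply: continuous_acos; rewrite /cos_side.
    have n0 : 0 < x * q x by rewrite mulr_gt0.
    have : 0 < x * q x / Num.sqrt ((4 - x ^+ 2) * (4 - q x ^+ 2)) by rewrite divr_gt0.
    have : x * q x / Num.sqrt ((4 - x ^+ 2) * (4 - q x ^+ 2)) < 1.
      (* Squared, this is p^2 q^2 < (4 - p^2) (4 - q^2), which is again p^2 + q^2 < 4. *)
      rewrite ltr_pdivrMr // mul1r -[ltLHS]gtr0_norm // -sqrtr_sqr ltr_sqrt //.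
      by rewrite exprMn; lra.
    lra.
  rewrite /cos_side; apply: cvgM; first exact: cvgM.
  apply: cvgV; first by rewrite gt_eqF.
  apply: (@continuous_cvg _ _ _ _ _ (fun y => (4 - y ^+ 2) * (4 - q y ^+ 2)) Num.sqrt); first exact: sqrt_continuous.
  by apply: cvgM; exact: c4.
have cbp := cpq id q cx cq Q0 pq.
have cbq : acos (cos_pq (q y) y) @[y --> x] --> acos (cos_pq (q x) x).
  by apply: (cpq q id) => //; rewrite addrC.
have c2 (f : R -> R) : f y @[y --> x] --> f x -> 2 * f y @[y --> x] --> 2 * f x.
  by move=> cf; apply: cvgM => //; exact: cvg_cst.
rewrite /balance; apply: cvgD; first apply: cvgD.
- by apply: cvgM; [exact: cvgM|exact: cvgB].
- by apply: cvgM; [exact: c2|exact: cvgB].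
- by apply: cvgM; [exact: c2|exact: cvgB].
Qed.

Lemma balance_root : exists2 x : R, 3 / 2 <= x <= 97 / 50 & balance x (9 / 10 / x) = 0.
Proof.
have [|||x] := @IVT R (fun x => balance x (9 / 10 / x)) (3 / 2) (97 / 50) 0.
- lra.
- apply: continuous_in_subspaceT => x; rewrite inE /= in_itv /=.
  exact: continuous_balance.
- rewrite (_ : 9 / 10 / (3 / 2) = 3 / 5); last by field.
  rewrite (_ : 9 / 10 / (97 / 50) = 45 / 97); last by field.
  by rewrite ge_min le_max balance_neg balance_pos orbT.
- by rewrite in_itv /= => xi E; exists x.
Qed.

Lemma nonunique_constant_L : exists L : 'M[R]_4, met L /\
  exists l1 l2, [/\ conformal_class L l1, conformal_class L l2,
    constant_L_curvature l1, constant_L_curvature l2 & forall c : R, l2 <> c *: l1].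
Proof.
have [x xi Ex] := balance_root; have [x0 q0 xq qx] := pq_range xi.
set q := 9 / 10 / x in Ex q0 xq qx.
(* The value p = q = s gives the equihedral metric of the class. *)
pose s : R := Num.sqrt (9 / 10).
have s2 : s * s = 9 / 10 by rewrite -expr2 sqr_sqrtr //; lra.
have s0 : 0 < s by rewrite sqrtr_gt0; lra.
have ml : met (pq_metric s s) by apply: pq_met => //; rewrite expr2; lra.
have ml2 : met (pq_metric x q) by exact: pq_met.
have sx : s * s = x * q by rewrite s2 /q [RHS]mulrC mulfVK // gt_eqF.
exists (pq_metric s s); split => //; exists (pq_metric s s), (pq_metric x q); split.
- by split => //; exact: pq_conformal.
- by split => //; exact: pq_conformal.
- by apply: equihedral_constant_L => //; apply: opposite_equihedral => //; split; rewrite !mxE.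
- exact: pq_constant_L.
(* A multiple of the first metric would have equal lengths on edges 01 and 23, contrary to q < x. *)
- move=> c /matrixP E; have := E o0 o1; have := E o2 o3; rewrite !mxE /= => q_eq x_eq.
  by move: qx; rewrite q_eq x_eq ltxx.
Qed.

End Nonuniqueness.

Theorem theorem4p5 (R : realType) :
  [/\ (forall l : 'M[R]_4, met l -> equihedral l -> constant_L_curvature l),
      (forall l : 'M[R]_4, met l -> equihedral l -> constant_V_curvature l),
      (forall L : 'M[R]_4, met L ->
         exists l, [/\ conformal_class L l, equihedral l &
           forall l', conformal_class L l' -> equihedral l' ->
             exists c : R, 0 < c /\ l' = c *: l])
    & (exists L : 'M[R]_4, met L /\
         exists l1 l2, [/\ conformal_class L l1, conformal_class L l2,
           constant_L_curvature l1, constant_L_curvature l2 &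
           forall c : R, l2 <> c *: l1])].
Proof.
split.
- exact: equihedral_constant_L.
- exact: equihedral_constant_V.
- move=> L mL; have [l cl el] := equihedral_exists mL.
  exists l; split=> // l' cl' el'; exact: equihedral_unique cl el cl' el'.
- exact: nonunique_constant_L.
Qed.
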